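(* Let $L\subseteq A^*$ be a language, $n$ a natural number and $\mathfrak{B}$ a set of binary predicates. Then $L$ is definable by a closed formula of $\mathrm{FO}^{n+}[\mathfrak{B}]$ if and only if there is a natural number $k$ such that for every pair of words $(u_0,u_1)$ with $u_0\in L$ and $u_1\notin L$, Spoiler has a winning strategy in the game $\mathrm{EF}_k^{n+}[\mathfrak{B}](u_0,u_1)$.
   Context: Let $\Sigma$ be a finite set of unary predicates and $A=2^\Sigma$. $\mathrm{FO}^{n+}[\mathfrak{B}]$ is the set of negation-free first-order formulas built from $\bot,\top$, unary atoms $a(x)$, $a\in\Sigma$ (true iff $a$ belongs to the letter at position $x$), binary atoms $\beta(x,y)$ with $\beta\in\mathfrak{B}$ (predicates on positions), $\wedge,\vee,\exists,\forall$, using only $n$ distinct variable names $x_1,\dots,x_n$ (reusable). The game $\mathrm{EF}_k^{n+}[\mathfrak{B}](u_0,u_1)$ is played between Spoiler and Duplicator for $k$ rounds on words $u_0,u_1$ with tokens numbered $1,\dots,n$ (initially unplaced). In each round Spoiler chooses $\delta\in\{0,1\}$ and $i\in\{1,\dots,n\}$ and places (or moves) token $i$ on a position of $u_\delta$; Duplicator then places (or moves) token $i$ on a position of $u_{1-\delta}$. Let $\nu_0,\nu_1$ map each placed token (viewed as a variable) to its position in $u_0$, $u_1$ respectively. After Duplicator's move the following must hold: for every $\beta\in\mathfrak{B}$ and placed tokens $x,y$, $(u_0,\nu_0)\models\beta(x,y)$ iff $(u_1,\nu_1)\models\beta(x,y)$; and for every $a\in\Sigma$ and placed token $x$, if $(u_0,\nu_0)\models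 a(x)$ then $(u_1,\nu_1)\models a(x)$ (equivalently, the letter under each token in $u_0$ is a subset of the letter under that token in $u_1$). If Duplicator cannot satisfy these constraints, Spoiler wins; if Spoiler has not won after $k$ rounds, Duplicator wins.
   Formalization: The set 𝔅 is taken finite, and for every β in 𝔅 the negation of β(x,y) is assumed expressible by a formula of FO^{n+}[𝔅] with free variables among x, y; without either assumption the right-to-left implication fails (e.g. 𝔅={≠}, n=2, words of length at most 1). *)

(* Defs.v *)
From mathcomp Require Import all_boot.

Set Implicit Arguments.
Unset Strict Implicit.
Unset Printing Implicit Defensive.

Notation word Sigma := (seq {set Sigma}).

(* Interpretation of the binary predicate symbols. A predicate may depend on
   the length l of the word, as numerical predicates do in general; <=, < and
   the successor relation are the instances that ignore it. *)
Definition binary_preds (B : Type) := B -> forall l : nat, 'I_l -> 'I_l -> Prop.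

(* FO^{n+}[B]: the variable names are the elements of 'I_n. *)
Inductive formula (Sigma B : Type) (n : nat) : Type :=
| FBot
| FTop
| FLetter of Sigma & 'I_n
| FBin of B & 'I_n & 'I_n
| FAnd of formula Sigma B n & formula Sigma B n
| FOr of formula Sigma B n & formula Sigma B n
| FExists of 'I_n & formula Sigma B n
| FForall of 'I_n & formula Sigma B n.

Arguments FBot {Sigma B n}.
Arguments FTop {Sigma B n}.
Arguments FLetter {Sigma B n} a x.
Arguments FBin {Sigma B n} b x y.

Fixpoint free_vars (Sigma B : Type) (n : nat) (f : formula Sigma B n) :
    {set 'I_n} :=
  match f with
  | FBot | FTop => set0
  | FLetter _ x => [set x]
  | FBin _ x y => [set x; y]
  | FAnd g h | FOr g h => free_vars g :|: free_vars h
  | FExists x g | FForall x g => free_vars g :\ x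
  end.

Definition closed (Sigma B : Type) (n : nat) (f : formula Sigma B n) : Prop :=
  free_vars f = set0.

(* Valuations are partial: [None] means an unassigned variable, or equivalently
   a token that has not been placed. *)
Definition valuation (Sigma : finType) (n : nat) (u : word Sigma) : Type :=
  'I_n -> option 'I_(size u).

Definition no_valuation (Sigma : finType) (n : nat) (u : word Sigma) :
  valuation n u := fun=> None.

Arguments no_valuation {Sigma} n u.

Definition assign (Sigma : finType) (n : nat) (u : word Sigma)
    (nu : valuation n u) (x : 'I_n) (p : 'I_(size u)) : valuation n u :=
  fun y => if y == x then Some p else nu y.

(* An atom with an unassigned variable is false; this value is irrelevant for a
   formula whose free variables are all assigned. *)
Fixpoint sat (Sigma : finType) (B : Type) (beta : binary_preds B) (n : nat)
    (u : word Sigma) (nu : valuation n u) (f : formula Sigma B n) : Prop :=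
  match f with
  | FBot => False
  | FTop => True
  | FLetter a x => if nu x is Some p then a \in nth set0 u p else False
  | FBin b x y =>
      match nu x, nu y with
      | Some p, Some q => beta b (size u) p q
      | _, _ => False
      end
  | FAnd g h => sat beta nu g /\ sat beta nu h
  | FOr g h => sat beta nu g \/ sat beta nu h
  | FExists x g => exists p : 'I_(size u), sat beta (assign nu x p) g
  | FForall x g => forall p : 'I_(size u), sat beta (assign nu x p) g
  end.

Definition definable (Sigma : finType) (B : Type) (beta : binary_preds B)
    (n : nat) (L : word Sigma -> Prop) : Prop :=
  exists f : formula Sigma B n,
    closed f /\ forall u, L u <-> sat beta (no_valuation n u) f.

(* Negated atoms ~ b(x,y) are expressible positively. This holds when B is
   closed under complement, possibly up to exchanging the arguments, as are
   {<=, <} and {<=, <, succ, nsucc}. Since formulas only have positive atoms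
   b(x,y) while the game compares b(x,y) by an equivalence, some assumption of
   this kind is needed: for B = {<>} and n = 2, Spoiler separates the words of
   length at most 1 from the longer ones in 2 rounds, but no formula does. *)
Definition negation_expressible (Sigma : finType) (B : Type)
    (beta : binary_preds B) (n : nat) : Prop :=
  forall (b : B) (x y : 'I_n),
  exists f : formula Sigma B n,
    free_vars f \subset [set x; y] /\
    forall (u : word Sigma) (nu : valuation n u), nu x -> nu y ->
      (sat beta nu f <-> ~ sat beta nu (FBin b x y)).

Arguments negation_expressible Sigma {B} beta n.

(* The constraint that Duplicator has to maintain. *)
Definition position_ok (Sigma : finType) (B : Type) (beta : binary_preds B)
    (n : nat) (u0 u1 : word Sigma) (nu0 : valuation n u0)
    (nu1 : valuation n u1) : Prop :=
  (forall (b : B) (x y : 'I_n), nu0 x -> nu0 y ->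
     (sat beta nu0 (FBin b x y) <-> sat beta nu1 (FBin b x y))) /\
  (forall (a : Sigma) (x : 'I_n), nu0 x ->
     sat beta nu0 (FLetter a x) -> sat beta nu1 (FLetter a x)).

(* Spoiler has a winning strategy when k rounds remain to be played from the
   tokens (nu0, nu1). A Spoiler without any legal move (no token, or both words
   empty) does not win; a Duplicator without any legal reply loses. *)
Fixpoint spoiler_wins_from (Sigma : finType) (B : Type)
    (beta : binary_preds B) (n : nat) (u0 u1 : word Sigma) (k : nat)
    (nu0 : valuation n u0) (nu1 : valuation n u1) : Prop :=
  match k with
  | 0 => False
  | k'.+1 =>
      let spoiler_wins_after i p0 p1 :=
        ~ position_ok beta (assign nu0 i p0) (assign nu1 i p1) \/
        spoiler_wins_from beta k' (assign nu0 i p0) (assign nu1 i p1) in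
      exists i : 'I_n,
        (exists p0 : 'I_(size u0), forall p1 : 'I_(size u1),
           spoiler_wins_after i p0 p1) \/
        (exists p1 : 'I_(size u1), forall p0 : 'I_(size u0),
           spoiler_wins_after i p0 p1)
  end.

(* EF_k^{n+}[B](u0, u1), starting with no token placed. *)
Definition spoiler_wins (Sigma : finType) (B : Type) (beta : binary_preds B)
    (n k : nat) (u0 u1 : word Sigma) : Prop :=
  spoiler_wins_from beta k (no_valuation n u0) (no_valuation n u1).

Arguments spoiler_wins {Sigma B} beta n k u0 u1.

(* Main.v *)
Require Import Defs.
From mathcomp Require Import all_boot.
From mathcomp Require Import boolp.

Set Implicit Arguments.
Unset Strict Implicit.
Unset Printing Implicit Defensive.

(** From a formula to a strategy: Spoiler follows the formula, playing a witness
    in [u0] for an existential quantifier and a counterexample in [u1] for a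
    universal one.

    From strategies to a formula: for every [k] there is a finite family of
    formulas such that Duplicator survives [k] rounds as soon as the truth of
    each member passes from [u0] to [u1].  The family for [k + 1] adds
    [exists x] of every conjunction and [forall x] of every disjunction of
    members of the family for [k].  A language whose pairs are separated in [k]
    rounds is then the disjunction, over its words, of the conjunction of the
    closed members true in that word. *)

(** Satisfaction is a mere [Prop]; classical logic turns it into finite sets of indices, over which
    conjunctions and disjunctions can range. *)
Lemma prop_finset (T : finType) (P : T -> Prop) :
  exists S : {set T}, forall x, x \in S <-> P x.
Proof. by exists [set x | `[< P x >]] => x; rewrite inE; split=> /asboolP. Qed.

Section Formulas.

Context {Sigma B : finType}.
Context {beta : binary_preds B} {n : nat}.

Implicit Types (f g : formula Sigma B n) (u : word Sigma).

Definition big_and (I : Type) (s : seq I) (F : I -> formula Sigma B n) :=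
  foldr (fun i g => FAnd (F i) g) FTop s.

Definition big_or (I : Type) (s : seq I) (F : I -> formula Sigma B n) :=
  foldr (fun i g => FOr (F i) g) FBot s.

Lemma sat_big_and u (nu : valuation n u) (I : eqType) (s : seq I) F :
  sat beta nu (big_and s F) <-> forall i, i \in s -> sat beta nu (F i).
Proof.
elim: s => [|j s IHs] //=; rewrite IHs; split=> [[Fj Fs] i | Fjs].
  by rewrite inE => /predU1P [-> | /Fs].
by split=> [|i si]; apply: Fjs; rewrite inE ?eqxx ?si ?orbT.
Qed.

Lemma sat_big_or u (nu : valuation n u) (I : eqType) (s : seq I) F :
  sat beta nu (big_or s F) <-> exists2 i, i \in s & sat beta nu (F i).
Proof.
elim: s => [|j s IHs] /=; first by split=> // -[].
rewrite IHs; split=> [[Fj | [i si Fi]] | [i]].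
- by exists j; rewrite ?inE ?eqxx.
- by exists i; rewrite ?inE ?si ?orbT.
- by rewrite inE => /predU1P [-> | si]; [left | right; exists i].
Qed.

Lemma free_vars_big_and (D : {set 'I_n}) (I : eqType) (s : seq I) F :
  (forall i, i \in s -> free_vars (F i) \subset D) ->
  free_vars (big_and s F) \subset D.
Proof.
elim: s => [|j s IHs] /= FD; first exact: sub0set.
rewrite subUset FD ?inE ?eqxx //=; apply: IHs => i si.
by rewrite FD // inE si orbT.
Qed.

Lemma free_vars_big_or (D : {set 'I_n}) (I : eqType) (s : seq I) F :
  (forall i, i \in s -> free_vars (F i) \subset D) ->
  free_vars (big_or s F) \subset D.
Proof.
elim: s => [|j s IHs] /= FD; first exact: sub0set.
rewrite subUset FD ?inE ?eqxx //=; apply: IHs => i si.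
by rewrite FD // inE si orbT.
Qed.

Fixpoint quantifier_rank f : nat :=
  match f with
  | FAnd g h | FOr g h => maxn (quantifier_rank g) (quantifier_rank h)
  | FExists _ g | FForall _ g => (quantifier_rank g).+1
  | _ => 0
  end.

(* No condition on free variables: an atom true under [nu0] has its variables
   placed. *)
Lemma spoiler_wins_of_sat u0 u1 f k (nu0 : valuation n u0)
    (nu1 : valuation n u1) :
  quantifier_rank f <= k -> position_ok beta nu0 nu1 ->
  sat beta nu0 f -> ~ sat beta nu1 f -> spoiler_wins_from beta k nu0 nu1.
Proof.
elim: f k nu0 nu1 => [||a x|b x y|g IHg h IHh|g IHg h IHh|x g IHg|x g IHg]
  k nu0 nu1 //= lek ok.
- have [_ /(_ a x) /=] := ok.
  by case: (nu0 x) => // p okx ax nax; case: nax; apply: okx.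
- have [/(_ b x y) /= + _] := ok.
  by case: (nu0 x) (nu0 y) => [p|] // [q|] // okxy bxy nbxy; case: nbxy; apply/okxy.
- move: lek; rewrite geq_max => /andP [leg leh] [sg sh] /not_andP [] ns.
    exact: IHg ns.
  exact: IHh ns.
- move: lek; rewrite geq_max => /andP [leg leh] + /not_orP [nsg nsh].
  by case=> s; [exact: IHg nsg | exact: IHh nsh].
- case: k lek => // k lek [p0 s0] ns1; exists x; left; exists p0 => p1.
  have [ok'|] := pselect (position_ok beta (assign nu0 x p0) (assign nu1 x p1));
    last by left.
  by right; apply: IHg => // s1; apply: ns1; exists p1.
- case: k lek => // k lek s0 /existsNP [p1 ns1]; exists x; right; exists p1 => p0.
  have [ok'|] := pselect (position_ok beta (assign nu0 x p0) (assign nu1 x p1));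
    last by left.
  by right; apply: IHg.
Qed.

Definition placed u (nu : valuation n u) : {set 'I_n} := [set x | isSome (nu x)].

Lemma placed_assign u (nu : valuation n u) x p :
  placed (assign nu x p) = x |: placed nu.
Proof. by apply/setP => y; rewrite !inE /assign; case: eqP. Qed.

(** Formulas with an unplaced variable are left out, since their truth rests on the default value of
    atoms. At the start of the game only closed formulas are compared. *)
Definition preserves (I : Type) (F : I -> formula Sigma B n) u0 u1
    (nu0 : valuation n u0) (nu1 : valuation n u1) :=
  forall i, free_vars (F i) \subset placed nu0 ->
    sat beta nu0 (F i) -> sat beta nu1 (F i).

(** The game compares binary predicates by an equivalence. Its converse direction is the
    contrapositive of preservation for the formula expressing the negated atom. *)
Lemma atoms_family : negation_expressible Sigma beta n ->
  exists (I : finType) (F : I -> formula Sigma B n),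
  forall u0 u1 (nu0 : valuation n u0) (nu1 : valuation n u1),
  preserves F nu0 nu1 -> position_ok beta nu0 nu1.
Proof.
move=> hneg.
have /choice [neg negP] (t : B * 'I_n * 'I_n) := hneg t.1.1 t.1.2 t.2.
exists (Sigma * 'I_n + (B * 'I_n * 'I_n) * bool)%type.
exists (fun i => match i with
  | inl (a, x) => FLetter a x
  | inr (t, true) => FBin t.1.1 t.1.2 t.2
  | inr (t, false) => neg t
  end).
move=> u0 u1 nu0 nu1 pres; split=> [b x y nu0x nu0y | a x nu0x]; last first.
  by apply: (pres (inl (a, x))); rewrite sub1set inE.
have xyD : [set x; y] \subset placed nu0.
  by apply/subsetP => z; rewrite !inE => /orP [] /eqP ->.
split; first exact: (pres (inr (b, x, y, true))).
have [/= neg_fv neg_sat] := negP (b, x, y).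
move=> b1; apply: contrapT => nb0.
(* Atoms with an unassigned variable are false, so [b1] shows that both variables are placed in
   [u1], as [neg_sat] requires. *)
have nu1x : nu1 x by move: b1 => /=; case: (nu1 x).
have nu1y : nu1 y by move: b1 => /=; case: (nu1 x) (nu1 y) => [?|] // [].
have /(neg_sat _ _ nu1x nu1y) : sat beta nu1 (neg (b, x, y)); last by [].
apply: (pres (inr (b, x, y, false))) => /=; first exact: subset_trans xyD.
exact/neg_sat.
Qed.

(** The family is chosen before the words, so that one formula can serve for all pairs. *)
Lemma duplicator_family (k : nat) : negation_expressible Sigma beta n ->
  exists (I : finType) (F : I -> formula Sigma B n),
  forall u0 u1 (nu0 : valuation n u0) (nu1 : valuation n u1),
  preserves F nu0 nu1 ->
  position_ok beta nu0 nu1 /\ ~ spoiler_wins_from beta k nu0 nu1.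
Proof.
move=> hneg; elim: k => [|k [I [F IH]]].
  have [I [F FP]] := atoms_family hneg.
  by exists I, F => u0 u1 nu0 nu1 /FP ok; split=> // -[].
exists (I + ('I_n * {set I}) * bool)%type.
exists (fun i : I + ('I_n * {set I}) * bool => match i with
  | inl j => F j
  | inr (x, A, true) => FExists x (big_and (enum A) F)
  | inr (x, A, false) => FForall x (big_or (enum A) F)
  end).
move=> u0 u1 nu0 nu1 pres; split.
  by have [] // := IH _ _ nu0 nu1 (fun j => pres (inl j)).
have dupl x p0 p1 :
    preserves F (assign nu0 x p0) (assign nu1 x p1) ->
    ~ (~ position_ok beta (assign nu0 x p0) (assign nu1 x p1) \/
       spoiler_wins_from beta k (assign nu0 x p0) (assign nu1 x p1)).
  by move=> /IH [ok nwin] [/(_ ok) | /nwin].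
case=> x [[p0 win] | [p1 win]].
(* [S] collects what holds in [u0] after Spoiler's move [p0]. The existential formula over its
   conjunction passes to [u1], and its witness there is Duplicator's reply. *)
- have [S SP] := prop_finset (fun j => free_vars (F j) \subset x |: placed nu0 /\
    sat beta (assign nu0 x p0) (F j)).
  have /= [||p1 /sat_big_and sat1] := pres (inr (x, S, true)).
  + by rewrite subDset; apply: free_vars_big_and => j; rewrite mem_enum => /SP [].
  + exists p0; apply/sat_big_and => j; rewrite mem_enum.
    by move=> /SP [].
  apply: (dupl x p0 p1) (win p1) => j; rewrite placed_assign => fvj sj.
  by apply: sat1; rewrite mem_enum; apply/SP.
(* Dually, [S] collects what fails in [u1] after the move [p1]. Some [p0] must falsify the whole
   disjunction, or else the universal formula would pass to [u1] and fail at [p1]; Duplicator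
   replies with it. *)
- have [S SP] := prop_finset (fun j => free_vars (F j) \subset x |: placed nu0 /\
    ~ sat beta (assign nu1 x p1) (F j)).
  have [p0 nsat0] : exists p0, ~ sat beta (assign nu0 x p0) (big_or (enum S) F).
    apply/existsNP => sat0.
    have /(_ p1) /sat_big_or [j] : sat beta nu1 (FForall x (big_or (enum S) F)).
    + apply: (pres (inr (x, S, false))) => //=.
      by rewrite subDset; apply: free_vars_big_or => j; rewrite mem_enum => /SP [].
    + by rewrite mem_enum => /SP [].
  apply: (dupl x p0 p1) (win p0) => j; rewrite placed_assign => fvj sj.
  apply: contrapT => nsj; apply: nsat0; apply/sat_big_or; exists j => //.
  by rewrite mem_enum; apply/SP.
Qed.

End Formulas.

Theorem theorem54 (Sigma : finType) (B : finType) (beta : binary_preds B)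
    (n : nat) (L : word Sigma -> Prop)
    (hneg : negation_expressible Sigma beta n) :
  definable beta n L <->
  exists k : nat, forall u0 u1 : word Sigma,
    L u0 -> ~ L u1 -> spoiler_wins beta n k u0 u1.
Proof.
split=> [[f [_ Lf]] | [k win]].
  exists (quantifier_rank f) => u0 u1 /Lf s0 L1.
  (* With no token placed, [position_ok] holds vacuously. *)
  by apply: spoiler_wins_of_sat s0 _ => // /Lf.
have [I [F FP]] := duplicator_family k hneg.
(* [L] may be infinite, but its words realise only finitely many sets of true closed members; [T] is
   the set of these. *)
have [T TP] := prop_finset (fun S : {set I} => exists2 u, L u &
  forall i, i \in S <-> Defs.closed (F i) /\ sat beta (no_valuation n u) (F i)).
exists (big_or (enum T) (fun S => big_and (enum S) F)); split.
  apply/eqP; rewrite -subset0; apply: free_vars_big_or => S.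
  rewrite mem_enum => /TP [u _ SP]; apply: free_vars_big_and => i.
  by rewrite mem_enum => /SP [-> _].
move=> u; split=> [Lu | /sat_big_or [S]].
  have [S SP] := prop_finset (fun i : I =>
    Defs.closed (F i) /\ sat beta (no_valuation n u) (F i)).
  apply/sat_big_or; exists S; first by rewrite mem_enum; apply/TP; exists u.
  by apply/sat_big_and => i; rewrite mem_enum => /SP [].
rewrite mem_enum => /TP [u0 Lu0 SP] /sat_big_and satS; apply: contrapT => nLu.
(* All closed members true in [u0] hold in [u], so Duplicator survives [k] rounds on this pair,
   against [win]. *)
have [|_ []] := FP u0 u (no_valuation n u0) (no_valuation n u); last exact: win.
move=> i fvi si; apply: satS; rewrite mem_enum; apply/SP; split=> //.
apply/eqP; rewrite -subset0; apply: subset_trans fvi _.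
by apply/subsetP => x; rewrite inE.
Qed.
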